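(* Let $M>m>0$ be real numbers, let $\mathcal{H}$ be a complex Hilbert space and let $A\in\mathcal{B}(\mathcal{H})$. (i) If $C_{M,m}(A)$ is accretive, then $|A|\le \frac{M+m}{2\sqrt{Mm}}\,\mathfrak{R}A$. (ii) If $C_{M,m}(\mathrm{i}A^* )$ is accretive, then $|A^*|\le \frac{M+m}{2\sqrt{Mm}}\,\mathfrak{I}A$. (iii) If $A$ is invertible and $C_{M,m}(A^{-1})$ is accretive, then $|A^{-1}|\le \frac{M+m}{2\sqrt{Mm}}\,\mathfrak{R}A^{-1}$.
   Context: $\mathcal{B}(\mathcal{H})$ is the algebra of bounded linear operators on $\mathcal{H}$, with identity $I$. $C_{M,m}(T)=(MI-T^* )(T-mI)$; $|T|=(T^*T)^{1/2}$; $\mathfrak{R}T=\frac{T+T^*}{2}$ and $\mathfrak{I}T=\frac{T-T^*}{2\mathrm{i}}$. $T$ is accretive if $\mathfrak{R}T\ge 0$ (positive semi-definite). For self-adjoint $S,T$, $S\le T$ means $T-S$ is positive semi-definite. *)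

(* Defs.v *)
From HB Require Import structures.
From mathcomp Require Import all_boot all_order all_algebra.
From mathcomp Require Import complex.
From mathcomp Require Import all_classical all_reals all_analysis.

Set Implicit Arguments.
Unset Strict Implicit.
Unset Printing Implicit Defensive.

Import Order.TTheory GRing.Theory Num.Theory.
Import numFieldNormedType.Exports.

Local Open Scope classical_set_scope.
Local Open Scope ring_scope.
Local Open Scope complex_scope.

(* The inner product is linear in its first argument and conjugate-linear in
   its second one. *)
HB.mixin Record CompleteNormedModule_isHilbert (R : realType) H
    of CompleteNormedModule R[i] H := {
  inner : {dot H for Num.conj};
  sqr_norm_inner : forall x : H, `|x| ^+ 2 = inner x x
}.

#[short(type="hilbertType")]
HB.structure Definition Hilbert (R : realType) :=
  {H of CompleteNormedModule_isHilbert R H & CompleteNormedModule R[i] H}.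

Section operators.
Context {R : realType} {H : hilbertType R}.
Implicit Types S T : H -> H.

Definition bounded_op T : Prop :=
  linear T /\ exists K : R[i], forall x, `|T x| <= K * `|x|.

(* In [adjoint], [sqrt_op] and [inverse_op], [get] picks an element of a set
   which has at most one element; it is nonempty, respectively, for every
   bounded T, for every positive semi-definite bounded T, and for every
   invertible T. *)
Definition adjoint T : H -> H :=
  get [set S | bounded_op S /\ forall x y, inner (T x) y = inner x (S y)].

(* [0 <= z] in R[i] means that z is real and nonnegative. *)
Definition psd_op T : Prop := forall x, 0 <= inner (T x) x.

Definition le_op S T : Prop := psd_op (T - S).

Definition sqrt_op T : H -> H :=
  get [set P | [/\ bounded_op P, psd_op P & P \o P = T]].

Definition abs_op T : H -> H := sqrt_op (adjoint T \o T).

Definition Re_op T : H -> H := 2^-1 *: (T + adjoint T).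

Definition Im_op T : H -> H := (2 * 'i)^-1 *: (T - adjoint T).

Definition accretive T : Prop := psd_op (Re_op T).

Definition is_inverse_op T S : Prop :=
  [/\ bounded_op S, T \o S = idfun & S \o T = idfun].

Definition invertible_op T : Prop := exists S, is_inverse_op T S.

Definition inverse_op T : H -> H := get [set S | is_inverse_op T S].

Definition C_op (M m : R) T : H -> H :=
  (M%:C *: (idfun : H -> H) - adjoint T) \o (T - m%:C *: (idfun : H -> H)).

End operators.

(* Main.v *)
Require Import Defs.
From mathcomp Require Import all_boot all_order all_algebra.
From mathcomp Require Import complex.
From mathcomp Require Import all_classical all_reals all_analysis.
From mathcomp Require Import ring lra.

(** Write <x, y> for the inner product and let T be bounded.  Expanding
    Re <(T - m) x, (M - T) x> >= 0, which is what accretivity of C_{M,m}(T) says,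
    gives
      |T x|^2 + M m |x|^2 <= (M + m) Re <T x, x>     ([C_op_accretive_le]).
    Let s = sqrt (M m) and P = |T|.  Since P is self-adjoint with P^2 = T^* T,
    |P x| = |T x|, so that
      0 <= |P x - s x|^2 = |T x|^2 - 2 s <P x, x> + M m |x|^2,
    and adding the two inequalities yields 2 s <P x, x> <= (M + m) Re <T x, x>,
    that is |T| <= (M + m) / (2 s) Re T ([abs_op_le_Re_op]).  The three claims are
    this inequality for T = A, T = i A^* and T = A^{-1}: in the second case
    T^* = - i A, hence T^* T = A A^* and Re T = Im A.

    This argument needs T^* and |T| to exist, which is where completeness of the
    space is used.  The adjoint comes from the Riesz representation theorem
    ([riesz_representation]): f = <., z> where z maximises 2 f(x) - |x|^2, and the
    parallelogram law makes maximising sequences Cauchy.  For the square root of a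
    positive operator T with ||T|| <= k, the operator B = I - T / k is a
    self-adjoint contraction, and a solution S of S = (B + S^2) / 2 satisfies
    (I - S)^2 = I - B = T / k.  The iterates S_0 = 0, S_{n+1} = (B + S_n^2) / 2
    are controlled by the real sequence a_0 = 0, a_{n+1} = (1 + a_n^2) / 2, which
    increases and is bounded by 1: both ||S_n|| <= a_n and
    ||S_{n+1} - S_n|| <= a_{n+1} - a_n hold, so S_n converges in operator norm.

    Everything is computed with the real inner product Re <x, y>; the imaginary
    part is recovered from Im <x, y> = Re <x, i y>. *)

Set Implicit Arguments.
Unset Strict Implicit.
Unset Printing Implicit Defensive.

Import Order.TTheory GRing.Theory Num.Theory.
Import numFieldNormedType.Exports.

Local Open Scope classical_set_scope.
Local Open Scope ring_scope.
Local Open Scope complex_scope.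

Section HilbertSpace.
Context {R : realType} {H : hilbertType R}.
Implicit Types (x y z : H) (a b : R) (S T B : H -> H).

(** * The real inner product and the norm *)

Lemma ReD (u v : R[i]) : complex.Re (u + v) = complex.Re u + complex.Re v.
Proof. by case: u; case: v. Qed.

(** The next five lemmas restate facts about sesquilinear forms with values typed
    in R[i], so that the operations of R[i] can be rewritten in them. *)
Lemma innerDl x y z : inner (x + y) z = inner x z + inner y z :> R[i].
Proof. exact: linearDl. Qed.

Lemma innerZl (c : R[i]) x y : inner (c *: x) y = c * inner x y :> R[i].
Proof. exact: linearZl_LR. Qed.

Lemma innerC x y : inner x y = conjc (inner y x) :> R[i].
Proof. by rewrite hermC /= expr0 mul1r. Qed.

Lemma innerDr x y z : inner x (y + z) = inner x y + inner x z :> R[i].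
Proof. exact: linearDr. Qed.

Lemma innerZr (c : R[i]) x y : inner x (c *: y) = conjc c * inner x y :> R[i].
Proof. exact: linearZr_LR. Qed.

Definition rinner x y : R := complex.Re (inner x y).
Definition hnorm x : R := complex.Re `|x|.

Lemma rinnerC x y : rinner x y = rinner y x.
Proof. by rewrite /rinner innerC; case: (inner y x : R[i]). Qed.

Lemma rinnerDl x y z : rinner (x + y) z = rinner x z + rinner y z.
Proof. by rewrite /rinner innerDl ReD. Qed.

Lemma rinnerZl a x y : rinner (a%:C *: x) y = a * rinner x y.
Proof.
by rewrite /rinner innerZl; case: (inner x y : R[i]) => p q /=; ring.
Qed.

Lemma Im_inner x y : complex.Im (inner x y) = rinner x ('i *: y).
Proof.
by rewrite /rinner innerZr; case: (inner x y : R[i]) => p q /=; ring.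
Qed.

Lemma rinner_iC x y : rinner x ('i *: y) = - rinner ('i *: x) y.
Proof.
by rewrite /rinner innerZr innerZl; case: (inner x y : R[i]) => p q /=; ring.
Qed.

Lemma hnormE x : `|x| = (hnorm x)%:C :> R[i].
Proof. by rewrite /hnorm RRe_real // ger0_real // normr_ge0. Qed.

Lemma hnorm_sqr x : hnorm x ^+ 2 = rinner x x.
Proof.
by rewrite /rinner -sqr_norm_inner hnormE -rmorphXn.
Qed.

Lemma rinnerDr x y z : rinner x (y + z) = rinner x y + rinner x z.
Proof. by rewrite ![rinner x _]rinnerC rinnerDl. Qed.

Lemma rinnerZr a x y : rinner x (a%:C *: y) = a * rinner x y.
Proof. by rewrite ![rinner x _]rinnerC rinnerZl. Qed.

Lemma rinnerNl x y : rinner (- x) y = - rinner x y.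
Proof.
by rewrite -scaleN1r -(rmorph1 (real_complex R)) -rmorphN rinnerZl mulN1r.
Qed.

Lemma rinnerNr x y : rinner x (- y) = - rinner x y.
Proof. by rewrite ![rinner x _]rinnerC rinnerNl. Qed.

Lemma rinnerBl x y z : rinner (x - y) z = rinner x z - rinner y z.
Proof. by rewrite rinnerDl rinnerNl. Qed.

Lemma rinnerBr x y z : rinner x (y - z) = rinner x y - rinner x z.
Proof. by rewrite rinnerDr rinnerNr. Qed.

Lemma rinner0r x : rinner x 0 = 0.
Proof. by have := rinnerBr x x x; rewrite !subrr. Qed.

Lemma hnorm_ge0 x : 0 <= hnorm x.
Proof. by rewrite -lecR -hnormE normr_ge0. Qed.

Lemma hnorm0 : hnorm 0 = 0.
Proof. by rewrite /hnorm normr0. Qed.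

Lemma hnorm_le0 x : hnorm x <= 0 -> x = 0.
Proof. by rewrite -lecR -hnormE normr_le0 => /eqP. Qed.

Lemma hnormN x : hnorm (- x) = hnorm x.
Proof. by rewrite /hnorm normrN. Qed.

Lemma hnormB x y : hnorm (x - y) = hnorm (y - x).
Proof. by rewrite /hnorm distrC. Qed.

Lemma hnormD_le x y : hnorm (x + y) <= hnorm x + hnorm y.
Proof. rewrite -lecR rmorphD /= -!hnormE; exact: ler_normD. Qed.

Lemma hnormZ a x : hnorm (a%:C *: x) = `|a| * hnorm x.
Proof.
apply: complexI; rewrite -hnormE normrZ hnormE rmorphM /=; congr (_ * _).
by rewrite normc_def /= expr0n addr0 sqrtr_sqr.
Qed.

Lemma Re_normr_ge0 (c : R[i]) : 0 <= complex.Re `|c|.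
Proof. by rewrite -lecR RRe_real ?normr_real //; exact: normr_ge0. Qed.

Lemma hnormZC (c : R[i]) x : hnorm (c *: x) = complex.Re `|c| * hnorm x.
Proof.
by rewrite {1}/hnorm normrZ hnormE; case: (`|c|) => p q /=; ring.
Qed.

Lemma hnormD_sqr x y :
  hnorm (x + y) ^+ 2 = hnorm x ^+ 2 + 2 * rinner x y + hnorm y ^+ 2.
Proof. by rewrite !hnorm_sqr rinnerDl !rinnerDr (rinnerC y x); ring. Qed.

Lemma hnormB_sqr x y :
  hnorm (x - y) ^+ 2 = hnorm x ^+ 2 - 2 * rinner x y + hnorm y ^+ 2.
Proof. by rewrite hnormD_sqr rinnerNr hnormN mulrN. Qed.

(** Cauchy-Schwarz: the norm being given with its triangle inequality, it suffices
    to square the latter. *)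
Lemma rinner_le x y : rinner x y <= hnorm x * hnorm y.
Proof.
have : hnorm (x + y) ^+ 2 <= (hnorm x + hnorm y) ^+ 2.
  by rewrite lerXn2r ?nnegrE ?addr_ge0 ?hnorm_ge0 ?hnormD_le.
rewrite hnormD_sqr sqrrD; nra.
Qed.

Lemma rinner_nondegenerate x y : (forall z, rinner z x = rinner z y) -> x = y.
Proof.
move=> xy; apply/eqP; rewrite -subr_eq0; apply/eqP/hnorm_le0.
rewrite -(@ler_pXn2r _ 2) ?nnegrE ?hnorm_ge0 //.
by rewrite hnorm_sqr expr0n rinnerBr xy subrr.
Qed.

(** Limits are taken in this form: an identity v = 0 in H, or an inequality, follows
    once it holds for every n up to a fixed multiple of a rate d n tending to 0. *)
Lemma le0_of_cvg0 (t K : R) (d : nat -> R) :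
  d @ \oo --> (0 : R) -> (forall n, t <= K * d n) -> t <= 0.
Proof.
move=> d0 td.
apply: (@cvgr_to_ge _ \oo _ _ (fun n => K * d n)); last exact: nearW.
by rewrite -[X in _ --> X](mulr0 K); exact: cvgM (cvg_cst K) d0.
Qed.

(** Completeness with an explicit rate, which the limit inherits; later proofs then
    need no other fact about convergence in H. *)
Lemma hilbert_complete (u : nat -> H) (d : nat -> R) :
    d @ \oo --> (0 : R) ->
    (forall n m, (n <= m)%N -> hnorm (u n - u m) <= d n) ->
  exists z, forall n, hnorm (u n - z) <= d n.
Proof.
move=> d0 ud.
have /cauchy_cvg/cvg_ex[z /cvgrPdist_le uz] : cauchy (u @ \oo).
  apply: cauchy_exP => e e0.
  have eE : e = (complex.Re e)%:C by rewrite RRe_real // gtr0_real.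
  have : 0 < complex.Re e by rewrite -ltcR -eE.
  move/cvgrPdist_lt : d0 => /[apply] -[N _ /(_ N (leqnn N))].
  rewrite sub0r normrN => dN; exists (u N); exists N => // n /= Nn.
  rewrite -ball_normE /= eE hnormE ltcR.
  exact: le_lt_trans (ud _ _ Nn) (le_lt_trans (ler_norm _) dN).
exists z => n; apply/ler_addgt0Pr => e e0.
have := uz e%:C; rewrite ltcR => /(_ e0)[N _ uN].
have := uN (maxn N n) (leq_maxl _ _); rewrite /= hnormE lecR => zu.
rewrite -(subrK (u (maxn N n)) (u n)) -addrA.
apply: le_trans (hnormD_le _ _) _; rewrite lerD ?ud ?leq_maxr //.
by rewrite hnormB.
Qed.

(** * Riesz representation *)

(** The representing vector is the maximiser of g x = 2 f x - |x|^2 (if f = <., z>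
    then g x = |z|^2 - |x - z|^2).  Stated for real functionals, since only the
    real part of the inner product is used. *)
Lemma riesz_representation (f : H -> R) (k : R) :
    (forall x y, f (x + y) = f x + f y) ->
    (forall a x, f (a%:C *: x) = a * f x) ->
    (forall x, f x <= k * hnorm x) ->
  exists z, forall x, f x = rinner x z.
Proof.
move=> fD fZ fk.
pose g x := 2 * f x - hnorm x ^+ 2.
have g_sup : has_sup (range g).
  split; first by exists (g 0), 0.
  exists (k ^+ 2) => _ [x _ <-]; rewrite /g.
  have := sqr_ge0 (k - hnorm x); have := fk x; rewrite sqrrB; nra.
have g_le x : g x <= sup (range g).
  by apply: ub_le_sup; [case: g_sup | exists x].
(* With tolerance (1 / (n + 1))^2 the parallelogram law gives the Cauchy rate
   2 / (n + 1). *)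
have h_gt0 n : 0 < harmonic n :> R by rewrite harmonic_gt0.
have /choice[u gu] n : exists x, sup (range g) - harmonic n ^+ 2 < g x.
  have [_ [x _ <-] xg] := sup_adherent (exprn_gt0 2 (h_gt0 n)) g_sup.
  by exists x.
have d0 : (fun n => 2 * harmonic n) @ \oo --> (0 : R).
  rewrite -[X in _ --> X](mulr0 2).
  exact: cvgM (cvg_cst (2 : R)) (@cvg_harmonic R).
have [|z uz] := hilbert_complete (u := u) d0.
  move=> n m nm.
  have hmn : harmonic m <= harmonic n :> R by rewrite lef_pV2 ?posrE // ler_nat.
  rewrite -(@ler_pXn2r _ 2) ?nnegrE ?hnorm_ge0 ?mulr_ge0 // ?ltW //.
  (* g at the midpoint of u n and u m is at most the supremum. *)
  have := g_le (2^-1%:C *: (u n + u m)); have := gu n; have := gu m.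
  rewrite /g fZ fD hnormZ exprMn hnormB_sqr hnormD_sqr.
  rewrite ger0_norm ?invr_ge0 // => gm gn gp.
  have hh : harmonic m ^+ 2 <= harmonic n ^+ 2 :> R.
    by rewrite ler_pXn2r ?nnegrE ?(ltW (h_gt0 _)).
  rewrite exprMn; lra.
(* Perturb u n in the direction t x, let n tend to infinity, and choose t so that
   the linear term dominates. *)
have fz x : f x <= rinner x z.
  rewrite leNgt -subr_gt0; apply/negP; set D := f x - _ => D0.
  have q0 := sqr_ge0 (hnorm x).
  pose t := D / (hnorm x ^+ 2 + 1).
  have q1 : 0 < hnorm x ^+ 2 + 1 by rewrite ltr_wpDl.
  have t0 : 0 < t by rewrite divr_gt0.
  have /le0_of_cvg0 : forall n, 2 * t * D - t ^+ 2 * hnorm x ^+ 2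
      <= (1 + 2 * t * hnorm x) * (2 * harmonic n).
    move=> n; have := g_le (u n + t%:C *: x); have := gu n.
    rewrite /g fD fZ hnormD_sqr rinnerZr hnormZ exprMn real_normK ?num_real //.
    have uzx : rinner (u n) x - rinner z x <= 2 * harmonic n * hnorm x.
      rewrite -rinnerBl; apply: le_trans (rinner_le _ _) _.
      by rewrite ler_wpM2r ?hnorm_ge0.
    have h1 : harmonic n <= 1 :> R by rewrite invf_le1 ?ler1n ?ltr0n.
    have hh : harmonic n ^+ 2 <= harmonic n :> R.
      by rewrite expr2 ler_piMl // ltW.
    have := ler_wpM2l (ltW t0) uzx; have := h_gt0 n.
    by rewrite /D (rinnerC z x); lra.
  move=> /(_ d0); rewrite leNgt => /negP; apply.
  have -> : 2 * t * D - t ^+ 2 * hnorm x ^+ 2 = t ^+ 2 * (hnorm x ^+ 2 + 2).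
    have -> : D = t * (hnorm x ^+ 2 + 1) by rewrite divfK // gt_eqF.
    by ring.
  by rewrite mulr_gt0 ?exprn_gt0 // ltr_wpDl.
exists z => x; apply/le_anti; rewrite fz /=.
have := fz (- x); rewrite rinnerNl -[- x]scaleN1r -(rmorph1 (real_complex R)).
by rewrite -rmorphN fZ mulN1r lerN2.
Qed.

(** * Bounded operators and adjoints *)

(** The constant in the definition of boundedness is complex; its real part, made
    nonnegative, serves as well. *)
Lemma bounded_opP T : bounded_op T <->
  linear T /\ exists2 k, 0 <= k & forall x, hnorm (T x) <= k * hnorm x.
Proof.
split=> -[Tl TK]; split=> //; last first.
  have [k _ Tk] := TK; exists k%:C => x.
  by rewrite !hnormE -rmorphM lecR Tk.
move: TK => [K TK].
exists (Num.max 0 (complex.Re K)) => [|x]; first by rewrite le_max lexx.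
have := TK x; rewrite !hnormE lecE => /andP[_].
have -> : complex.Re (K * (hnorm x)%:C) = complex.Re K * hnorm x.
  by case: K {TK} => p q /=; ring.
by move=> /le_trans; apply; rewrite ler_wpM2r ?hnorm_ge0 // le_max lexx orbT.
Qed.

(** Both sides are convertible; the right-hand one spells out the operations of H
    in the form in which rewriting expects them. *)
Lemma linear_opP T :
  linear T <-> forall (c : R[i]) x y, T (c *: x + y) = c *: T x + T y.
Proof. by []. Qed.

Lemma linear_opD T : linear T -> forall x y, T (x + y) = T x + T y.
Proof. by move=> Tl x y; have := Tl 1 x y; rewrite !scale1r. Qed.

Lemma linear_op0 T : linear T -> T 0 = 0.
Proof.
by move=> Tl; have := Tl (-1) 0 0; rewrite scaler0 addr0 scaleN1r addNr.
Qed.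

Lemma linear_opZ T : linear T -> forall c x, T (c *: x) = c *: T x.
Proof.
by move=> Tl c x; have := Tl c x 0; rewrite (linear_op0 Tl) !addr0.
Qed.

Lemma linear_opB T : linear T -> forall x y, T (x - y) = T x - T y.
Proof.
by move=> Tl x y; rewrite (linear_opD Tl) -scaleN1r (linear_opZ Tl) scaleN1r.
Qed.

Definition is_adjoint T S := forall x y, inner (T x) y = inner x (S y) :> R[i].

(** Complex-linearity of T turns the identity between real parts, applied to i x,
    into the one between imaginary parts. *)
Lemma is_adjointP T S : linear T ->
  (forall x y, rinner (T x) y = rinner x (S y)) -> is_adjoint T S.
Proof.
move=> Tl TS x y; apply/eqP; rewrite eq_complex.
rewrite -/(rinner _ _) -/(rinner _ _) TS eqxx /= !Im_inner.
by rewrite !rinner_iC -TS (linear_opZ Tl).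
Qed.

Lemma adjoint_spec T : bounded_op T ->
  bounded_op (adjoint T) /\ is_adjoint T (adjoint T).
Proof.
move=> Tb; rewrite /adjoint.
suff : exists S, bounded_op S /\ is_adjoint T S by move/getPex.
have /bounded_opP[Tl [k k0 Tk]] := Tb.
have /choice[S TS] y : exists z, forall x, rinner (T x) y = rinner x z.
  apply: (@riesz_representation _ (k * hnorm y)) => [x z|a x|x].
  - by rewrite (linear_opD Tl) rinnerDl.
  - by rewrite (linear_opZ Tl) rinnerZl.
  - apply: le_trans (rinner_le _ _) _.
    by rewrite mulrAC ler_wpM2r ?hnorm_ge0.
have {}TS : is_adjoint T S by apply: is_adjointP => // x y; exact: TS.
have rTS x y : rinner (T x) y = rinner x (S y) by rewrite /rinner TS.
exists S; split => //; apply/bounded_opP; split.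
  move=> c x y; apply: rinner_nondegenerate => z.
  by rewrite /rinner -TS !innerDr !innerZr !TS.
exists k => // x; have [->|Sx0] := eqVneq (hnorm (S x)) 0.
  by rewrite mulr_ge0 ?hnorm_ge0.
have Sx_gt0 : 0 < hnorm (S x) by rewrite lt_def Sx0 hnorm_ge0.
rewrite -(ler_pM2r Sx_gt0) -expr2 hnorm_sqr -rTS.
apply: le_trans (rinner_le _ _) _.
by rewrite mulrAC ler_wpM2r ?hnorm_ge0.
Qed.

Lemma bounded_op_id : bounded_op (idfun : H -> H).
Proof. by apply/bounded_opP; split=> //; exists 1 => // x; rewrite mul1r. Qed.

Lemma bounded_opZ (c : R[i]) T : bounded_op T -> bounded_op (c *: T).
Proof.
move=> /bounded_opP[Tl [k k0 Tk]]; apply/bounded_opP; split.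
  apply/linear_opP => d x y; rewrite !fctE ((linear_opP _).1 Tl).
  by rewrite (scalerDr c) !scalerA (mulrC c).
have c0 := Re_normr_ge0 c.
exists (complex.Re `|c| * k) => [|x]; first by rewrite mulr_ge0.
by rewrite fctE hnormZC -mulrA ler_wpM2l.
Qed.

Lemma bounded_opB S T : bounded_op S -> bounded_op T -> bounded_op (S - T).
Proof.
move=> /bounded_opP[Sl [k k0 Sk]] /bounded_opP[Tl [l l0 Tl']].
apply/bounded_opP; split.
  apply/linear_opP => d x y.
  rewrite !fctE ((linear_opP _).1 Sl) ((linear_opP _).1 Tl) (scalerBr d).
  by rewrite opprD addrACA.
exists (k + l) => [|x]; first by rewrite addr_ge0.
by rewrite fctE mulrDl; apply: le_trans (hnormD_le _ _) _; rewrite hnormN lerD.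
Qed.

Lemma bounded_op_comp S T : bounded_op S -> bounded_op T -> bounded_op (S \o T).
Proof.
move=> /bounded_opP[Sl [k k0 Sk]] /bounded_opP[Tl [l l0 Tk]].
apply/bounded_opP; split.
  apply/linear_opP => d x y /=.
  by rewrite ((linear_opP _).1 Tl) ((linear_opP _).1 Sl).
exists (k * l) => [|x /=]; first by rewrite mulr_ge0.
by apply: le_trans (Sk _) _; rewrite -mulrA ler_wpM2l.
Qed.

Lemma is_adjoint_rinner T S x y :
  is_adjoint T S -> rinner (T x) y = rinner x (S y).
Proof. by move=> TS; rewrite /rinner TS. Qed.

Lemma adjoint_unique T S : bounded_op T -> is_adjoint T S -> adjoint T = S.
Proof.
move=> Tb TS; have [_ Tadj] := adjoint_spec Tb.
apply: funext => y; apply: rinner_nondegenerate => x.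
by rewrite -(is_adjoint_rinner _ _ Tadj) (is_adjoint_rinner _ _ TS).
Qed.

Lemma adjointK T : bounded_op T -> adjoint (adjoint T) = T.
Proof.
move=> Tb; have [Tab Tadj] := adjoint_spec Tb.
apply: adjoint_unique => // x y; rewrite innerC -Tadj.
by rewrite [RHS]innerC.
Qed.

Lemma adjointZ (c : R[i]) T :
  bounded_op T -> adjoint (c *: T) = conjc c *: adjoint T.
Proof.
move=> Tb; have [_ Tadj] := adjoint_spec Tb.
apply: adjoint_unique; first exact: bounded_opZ.
by move=> x y; rewrite !fctE innerZl innerZr conjcK Tadj.
Qed.

(** * Positive operators and their square roots *)

Definition symmetric_op T := forall x y, rinner (T x) y = rinner x (T y).

(** On a complex space, positivity implies symmetry: <T z, z> is real for every z,
    and polarisation at z = x - i y gives Re <T x, y> = Re <x, T y>. *)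
Lemma psd_opP T : linear T ->
  psd_op T <-> symmetric_op T /\ forall x, 0 <= rinner (T x) x.
Proof.
move=> Tl; split=> [T0|[Ts T0] x]; last first.
  rewrite lecE /= T0 andbT Im_inner; apply/eqP.
  have := Ts ('i *: x) x; rewrite (linear_opZ Tl) (rinnerC ('i *: x)).
  (* Symmetry gives Re <T x, i x> = - Re <T x, i x>. *)
  by have := rinner_iC (T x) x; lra.
have {T0} T0 x : 0 <= rinner (T x) x /\ rinner (T x) ('i *: x) = 0.
  by have := T0 x; rewrite lecE /= -Im_inner => /andP[/eqP].
split=> [x y|x]; last by case: (T0 x).
have i2 z : 'i *: ('i *: z) = - z by rewrite scalerA -expr2 sqr_i scaleN1r.
have [_ +] := T0 (x - 'i *: y); have [_ +] := T0 x; have [_ +] := T0 ('i *: y).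
rewrite (linear_opB Tl) !(linear_opZ Tl) !scalerBr !i2 opprK.
rewrite !rinnerBl !rinnerDr !rinnerNr (rinner_iC ('i *: T y) x) i2.
by rewrite rinnerNl opprK (rinnerC x (T y)); lra.
Qed.

(** Expand <T z, z> >= 0 at z = k x - T x.  This is what makes I - T / k a
    contraction. *)
Lemma psd_op_sqr_le T (k : R) : linear T -> psd_op T -> 0 < k ->
    (forall x, hnorm (T x) <= k * hnorm x) ->
  forall x, hnorm (T x) ^+ 2 <= k * rinner (T x) x.
Proof.
move=> Tl /(psd_opP Tl)[Ts T0] k0 Tk x.
have := T0 (k%:C *: x - T x).
rewrite (linear_opB Tl) (linear_opZ Tl) rinnerBl !rinnerBr !rinnerZl !rinnerZr.
rewrite (Ts (T x) x) -!hnorm_sqr => h.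
have TT : rinner (T (T x)) (T x) <= k * hnorm (T x) ^+ 2.
  rewrite expr2 mulrA; apply: le_trans (rinner_le _ _) _.
  by rewrite ler_wpM2r ?hnorm_ge0.
rewrite -(ler_pM2l k0); lra.
Qed.

(** Picard iteration for the equation S = (B + S^2) / 2. *)
Fixpoint sqrt_iter B n : H -> H :=
  if n is n'.+1 then
    fun x => (2^-1)%:C *: (B x + sqrt_iter B n' (sqrt_iter B n' x))
  else fun=> 0.

(** The iteration above for B = 1 on the real line; it dominates the operator one
    term by term. *)
Fixpoint sqrt_majorant n : R :=
  if n is n'.+1 then 2^-1 * (1 + sqrt_majorant n' ^+ 2) else 0.

Lemma sqrt_majorant_itv n : 0 <= sqrt_majorant n <= 1.
Proof.
by elim: n => [|n /andP[a0 a1]] /=; [rewrite lexx ler01|apply/andP; nra].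
Qed.

Lemma sqrt_majorant_leS n : sqrt_majorant n <= sqrt_majorant n.+1.
Proof.
(* The difference is (1 - a n)^2 / 2. *)
by rewrite /=; have := sqr_ge0 (sqrt_majorant n - 1); rewrite sqrrB; lra.
Qed.

Lemma sqrt_majorant_cvg : exists l, [/\ l <= 1,
  forall n, sqrt_majorant n <= l & sqrt_majorant @ \oo --> l].
Proof.
have a_homo : {homo sqrt_majorant : n m / (n <= m)%N >-> n <= m}.
  by apply: homo_leq => //; [exact: le_trans|exact: sqrt_majorant_leS].
have a_cvg : cvgn sqrt_majorant.
  apply: nondecreasing_is_cvgn => //; exists 1 => _ [n _ <-].
  by case/andP: (sqrt_majorant_itv n).
exists (limn sqrt_majorant); split=> [|n|//].
  by apply: limr_le => //; apply: nearW => n; case/andP: (sqrt_majorant_itv n).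
exact: nondecreasing_cvgn_le.
Qed.

Section iteration.
Context (B : H -> H) (Bl : linear B) (Bs : symmetric_op B).
Context (B1 : forall x, hnorm (B x) <= hnorm x).

Let Y := sqrt_iter B.
Let a := sqrt_majorant.

Let a_ge0 n : 0 <= a n. Proof. by case/andP: (sqrt_majorant_itv n). Qed.

Lemma sqrt_iter_linear n : linear (Y n).
Proof.
apply/linear_opP; elim: n => [|n IHn] c x y.
  by rewrite /= scaler0 addr0.
rewrite /Y /= -/Y (linear_opP B).1 // !IHn addrACA -scalerDr.
by rewrite (scalerDr _ (c *: _)) !scalerA (mulrC c).
Qed.

Lemma sqrt_iter_symmetric n : symmetric_op (Y n).
Proof.
elim: n => [|n IHn] x y /=.
  by rewrite rinnerC !rinner0r.
by rewrite /Y /= -/Y rinnerZl rinnerZr rinnerDl rinnerDr Bs !IHn.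
Qed.

Lemma hnorm_sqrt_iter n x : hnorm (Y n x) <= a n * hnorm x.
Proof.
elim: n x => [|n IHn] x; first by rewrite mul0r /= hnorm0.
rewrite /Y /= -/Y -/a hnormZ ger0_norm ?invr_ge0 //.
rewrite -mulrA ler_wpM2l ?invr_ge0 //.
rewrite mulrDl mul1r; apply: le_trans (hnormD_le _ _) _; rewrite lerD //.
apply: le_trans (IHn _) _; rewrite expr2 -mulrA ler_wpM2l //; exact: IHn.
Qed.

(** Y_{n+2} - Y_{n+1} = (Y_{n+1} (Y_{n+1} - Y_n) + (Y_{n+1} - Y_n) Y_n) / 2, an
    identity that does not require the iterates to commute, and the majorant
    satisfies the same recursion. *)
Lemma hnorm_sqrt_iterS n x :
  hnorm (Y n.+1 x - Y n x) <= (a n.+1 - a n) * hnorm x.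
Proof.
elim: n x => [|n IHn] x; first by rewrite !subr0; exact: hnorm_sqrt_iter.
have -> : Y n.+2 x - Y n.+1 x = (2^-1)%:C *:
    (Y n.+1 (Y n.+1 x - Y n x) + (Y n.+1 (Y n x) - Y n (Y n x))).
  rewrite (linear_opB (sqrt_iter_linear n.+1)) addrA subrK.
  rewrite [Y n.+2 x]/= [in LHS]/Y [in X in _ - X = _]/= -/Y -scalerBr.
  by rewrite opprD addrACA subrr add0r.
rewrite hnormZ ger0_norm ?invr_ge0 //.
have -> : a n.+2 - a n.+1 =
    2^-1 * (a n.+1 * (a n.+1 - a n) + (a n.+1 - a n) * a n).
  have aS k : a k.+1 = 2^-1 * (1 + a k ^+ 2) by [].
  by rewrite (aS n.+1) [X in _ - X = _](aS n); ring.
rewrite -mulrA ler_wpM2l ?invr_ge0 // mulrDl.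
have da : 0 <= a n.+1 - a n by rewrite subr_ge0 sqrt_majorant_leS.
apply: le_trans (hnormD_le _ _) _; rewrite lerD //.
  by apply: le_trans (hnorm_sqrt_iter _ _) _; rewrite -mulrA ler_wpM2l.
by apply: le_trans (IHn _) _; rewrite -mulrA ler_wpM2l ?hnorm_sqrt_iter.
Qed.

Lemma hnorm_sqrt_iterB n m x : (n <= m)%N ->
  hnorm (Y n x - Y m x) <= (a m - a n) * hnorm x.
Proof.
move=> /subnKC <-; elim: (m - n)%N => [|k IHk].
  by rewrite addn0 !subrr mul0r hnorm0.
rewrite addnS -(subrK (Y (n + k) x) (Y n x)) -addrA.
apply: le_trans (hnormD_le _ _) _; apply: le_trans (lerD IHk _) _.
  by rewrite hnormB; exact: hnorm_sqrt_iterS.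
by rewrite -mulrDl addrC addrA subrK.
Qed.

(** S is the limit of the iterates, with |Y n x - S x| <= |x| (l - a n) where l is
    the limit of the majorant.  Each property of S is inherited from the iterates
    through this estimate. *)
Lemma half_square_fixpoint : exists S,
  [/\ linear S, symmetric_op S, forall x, hnorm (S x) <= hnorm x &
      forall x, S x = (2^-1)%:C *: (B x + S (S x))].
Proof.
have [l [l1 a_le a_cvg]] := sqrt_majorant_cvg.
pose d n := l - a n.
have d0 : d @ \oo --> (0 : R).
  by rewrite -[X in _ --> X](subrr l); exact: cvgB (cvg_cst l) a_cvg.
have /choice[S YS] x : exists z, forall n, hnorm (Y n x - z) <= hnorm x * d n.
  apply: (hilbert_complete (u := Y ^~ x) (d := fun n => hnorm x * d n)) =>
    [|n m nm].
    by rewrite -[X in _ --> X](mulr0 (hnorm x)); exact: cvgM (cvg_cst _) d0.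
  rewrite mulrC; apply: le_trans (hnorm_sqrt_iterB _ nm) _.
  by rewrite ler_wpM2r ?hnorm_ge0 // lerD2r a_le.
have S1 x : hnorm (S x) <= hnorm x.
  rewrite -(subrK (Y 0 x) (S x)); apply: le_trans (hnormD_le _ _) _.
  rewrite {2}/Y /= hnorm0 addr0 hnormB; apply: le_trans (YS x 0) _.
  by rewrite /d /= subr0 ler_piMr ?hnorm_ge0.
exists S; split=> //.
- apply/linear_opP => c x y; apply/eqP; rewrite -subr_eq0; apply/eqP/hnorm_le0.
  pose K := hnorm (c *: x + y) + complex.Re `|c| * hnorm x + hnorm y.
  apply: (le0_of_cvg0 (K := K) d0) => n.
  have -> : S (c *: x + y) - (c *: S x + S y) =
      (S (c *: x + y) - Y n (c *: x + y)) + (c *: (Y n x - S x) + (Y n y - S y)).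
    have E := (linear_opP _).1 (sqrt_iter_linear n) c x y.
    by rewrite scalerBr (addrACA (c *: Y n x)) -E -opprD addrA subrK.
  apply: le_trans (hnormD_le _ _) _; rewrite /K -addrA mulrDl.
  rewrite lerD //; first by rewrite hnormB.
  apply: le_trans (hnormD_le _ _) _; rewrite mulrDl lerD // hnormZC.
  rewrite -mulrA ler_wpM2l //.
  exact: Re_normr_ge0.
- suff Sle x y : rinner (S x) y - rinner x (S y) <= 0.
    move=> x y; apply/le_anti; have := Sle x y; have := Sle y x.
    rewrite (rinnerC (S y) x) (rinnerC y); move=> *; lra.
  apply: (le0_of_cvg0 (K := (2 * (hnorm x * hnorm y))) d0) => n.
  have h1 := rinner_le (S x - Y n x) y.
  have h2 := rinner_le x (Y n y - S y).
  move: h1 h2; rewrite rinnerBl rinnerBr sqrt_iter_symmetric hnormB => h1 h2.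
  have := ler_wpM2r (hnorm_ge0 y) (YS x n).
  have := ler_wpM2l (hnorm_ge0 x) (YS y n); lra.
- move=> x; apply/eqP; rewrite -subr_eq0; apply/eqP/hnorm_le0.
  pose K := hnorm x + 2^-1 * (hnorm x + hnorm (S x)).
  apply: (le0_of_cvg0 (K := K) d0) => n.
  have -> : S x - (2^-1)%:C *: (B x + S (S x)) = (S x - Y n.+1 x)
      + (2^-1)%:C *: (Y n (Y n x - S x) + (Y n (S x) - S (S x))).
    rewrite (linear_opB (sqrt_iter_linear n)) [Y n.+1 x]/= -/(Y n) -/(Y n _).
    rewrite -addrA; congr (_ + _); apply/eqP.
    rewrite eq_sym addrC subr_eq -scalerN -scalerDr; apply/eqP; congr (_ *: _).
    by rewrite addrA subrK opprD addrACA addNr add0r addrC.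
  have dS : d n.+1 <= d n by rewrite lerD2l lerN2 sqrt_majorant_leS.
  have h1 : hnorm (S x - Y n.+1 x) <= hnorm x * d n.
    by rewrite hnormB; apply: le_trans (YS _ _) _; rewrite ler_wpM2l ?hnorm_ge0.
  have a1 : a n <= 1 by case/andP: (sqrt_majorant_itv n).
  have h2 : hnorm (Y n (Y n x - S x)) <= hnorm x * d n.
    apply: le_trans (hnorm_sqrt_iter _ _) _; apply: le_trans (YS _ _).
    by rewrite ler_piMl ?hnorm_ge0.
  apply: le_trans (hnormD_le _ _) _; rewrite hnormZ ger0_norm ?invr_ge0 //.
  have := hnormD_le (Y n (Y n x - S x)) (Y n (S x) - S (S x)).
  have := YS (S x) n; rewrite /K; lra.
Qed.

End iteration.

(** P = sqrt k (I - S), where S = (B + S^2) / 2 for B = I - T / k. *)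
Lemma psd_sqrt_exists T : bounded_op T -> psd_op T ->
  exists P, [/\ bounded_op P, psd_op P & P \o P = T].
Proof.
move=> /bounded_opP[Tl [k0 k0_ge0 Tk0]] T0.
have [Ts Tp] := (psd_opP Tl).1 T0.
(* Adding 1 keeps k positive even if T = 0. *)
pose k := k0 + 1; have k_gt0 : 0 < k by rewrite ltr_wpDl.
have k_unit : k != 0 by rewrite gt_eqF.
have Tk x : hnorm (T x) <= k * hnorm x.
  by apply: le_trans (Tk0 x) _; rewrite ler_wpM2r ?hnorm_ge0 // ler_wpDr.
have T2 := psd_op_sqr_le Tl T0 k_gt0 Tk.
pose B x := x - (k^-1)%:C *: T x.
have Bl : linear B.
  apply/linear_opP => c x y.
  rewrite /B ((linear_opP _).1 Tl) (scalerDr _ (c *: _)) (scalerBr c) !scalerA.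
  by rewrite (mulrC c) opprD addrACA.
have Bs : symmetric_op B.
  by move=> x y; rewrite /B rinnerBl rinnerBr rinnerZl rinnerZr Ts.
have B1 x : hnorm (B x) <= hnorm x.
  rewrite -(@ler_pXn2r _ 2) ?nnegrE ?hnorm_ge0 // /B hnormB_sqr hnormZ rinnerZr.
  rewrite exprMn real_normK ?num_real // (rinnerC x).
  have : k^-1 ^+ 2 * hnorm (T x) ^+ 2 <= k^-1 * rinner (T x) x.
    rewrite expr2 -mulrA ler_pM2l ?invr_gt0 //.
    by rewrite -(ler_pM2l k_gt0) mulrA divff // mul1r.
  have : 0 <= k^-1 * rinner (T x) x by rewrite mulr_ge0 // invr_ge0 ltW.
  lra.
have [S [Sl Ss S1 SE]] := half_square_fixpoint Bl Bs B1.
pose P x := (Num.sqrt k)%:C *: (x - S x).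
have Pl : linear P.
  apply/linear_opP => c x y.
  rewrite /P ((linear_opP _).1 Sl) opprD addrACA -(scalerBr c).
  by rewrite (scalerDr _ (c *: _)) !scalerA (mulrC c).
have S2 x z : rinner z (S (S x)) = 2 * rinner z (S x) - rinner z (B x).
  rewrite {2}(SE x) rinnerZr rinnerDr mulrA mulfV // mul1r.
  by rewrite addrAC subrr add0r.
exists P; split.
- apply/bounded_opP; split=> //; exists (Num.sqrt k * 2) => [|x].
    by rewrite mulr_ge0 ?sqrtr_ge0.
  rewrite /P hnormZ ger0_norm ?sqrtr_ge0 // -mulrA ler_wpM2l ?sqrtr_ge0 //.
  by apply: le_trans (hnormD_le _ _) _; rewrite hnormN; have := S1 x; lra.
- apply/psd_opP => //; split=> [x y|x].
    by rewrite /P rinnerZl rinnerZr rinnerBl rinnerBr Ss.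
  rewrite /P rinnerZl mulr_ge0 ?sqrtr_ge0 // rinnerBl subr_ge0 -hnorm_sqr expr2.
  by apply: le_trans (rinner_le _ _) _; rewrite ler_wpM2r ?hnorm_ge0.
- apply: funext => x /=; apply: rinner_nondegenerate => z.
  rewrite /P (linear_opZ Sl) (linear_opB Sl).
  rewrite !(rinnerBr, rinnerZr) S2 /B rinnerBr rinnerZr.
  transitivity (Num.sqrt k ^+ 2 * k^-1 * rinner z (T x)); first by ring.
  by rewrite sqr_sqrtr ?ltW // divff // mul1r.
Qed.

(** * Accretivity of C_{M,m}(T) and the bound on |T| *)

Lemma inner_Re_op T x : bounded_op T ->
  inner (Re_op T x) x = (rinner (T x) x)%:C :> R[i].
Proof.
move=> /adjoint_spec[_ Tadj]; rewrite /Re_op !fctE innerZl innerDl.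
by rewrite (innerC (adjoint T x)) -Tadj addcJ mulrA mulVf ?mul1r.
Qed.

Lemma accretiveP T :
  bounded_op T -> accretive T <-> forall x, 0 <= rinner (T x) x.
Proof.
by move=> Tb; split=> T0 x; have := T0 x; rewrite inner_Re_op // lecR.
Qed.

Lemma abs_op_spec T : bounded_op T ->
  [/\ bounded_op (abs_op T), psd_op (abs_op T) &
      abs_op T \o abs_op T = adjoint T \o T].
Proof.
move=> Tb; have [Tab Tadj] := adjoint_spec Tb.
have TTb : bounded_op (adjoint T \o T) by exact: bounded_op_comp.
suff /(psd_sqrt_exists TTb)/getPex : psd_op (adjoint T \o T) by [].
apply/(psd_opP (proj1 TTb)); split=> [x y|x] /=.
  rewrite -(is_adjoint_rinner _ _ Tadj) rinnerC.
  by rewrite -(is_adjoint_rinner _ _ Tadj) rinnerC.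
by rewrite rinnerC -(is_adjoint_rinner _ _ Tadj) -hnorm_sqr sqr_ge0.
Qed.

Lemma hnorm_abs_op T x : bounded_op T -> hnorm (abs_op T x) = hnorm (T x).
Proof.
move=> Tb; have [_ Tadj] := adjoint_spec Tb.
have [[Pl _] /(psd_opP Pl)[Ps _] P2] := abs_op_spec Tb.
apply/eqP; rewrite -(@eqrXn2 _ 2) ?hnorm_ge0 // !hnorm_sqr Ps.
have -> : abs_op T (abs_op T x) = adjoint T (T x) by have := congr1 (@^~ x) P2.
by rewrite -(is_adjoint_rinner _ _ Tadj).
Qed.

(** Re <(M - T^* ) (T - m) x, x> = Re <(T - m) x, (M - T) x>, expanded. *)
Lemma C_op_accretive_le (M m : R) T x :
    bounded_op T -> accretive (C_op M m T) ->
  hnorm (T x) ^+ 2 + M * m * hnorm x ^+ 2 <= (M + m) * rinner (T x) x.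
Proof.
move=> Tb; have [Tab Tadj] := adjoint_spec Tb.
have Ib a : bounded_op (a%:C *: (idfun : H -> H)).
  exact/bounded_opZ/bounded_op_id.
have Cb : bounded_op (C_op M m T).
  by apply: bounded_op_comp; apply: bounded_opB.
move=> /(accretiveP Cb)/(_ x).
rewrite /C_op /= !fctE rinnerBl [X in _ - X]rinnerC.
rewrite -(is_adjoint_rinner _ _ Tadj).
rewrite !(rinnerBl, rinnerBr, rinnerZl, rinnerZr) !hnorm_sqr. lra.
Qed.

(** The scalar inequality behind it is 0 <= | |T| x - s x |^2 with s = sqrt (M m). *)
Lemma abs_op_le_Re_op (M m : R) T : 0 < M -> 0 < m -> bounded_op T ->
    accretive (C_op M m T) ->
  le_op (abs_op T) (((M + m) / (2 * Num.sqrt (M * m)))%:C *: Re_op T).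
Proof.
move=> M0 m0 Tb TC x; have [_ P0 _] := abs_op_spec Tb.
have Pr : inner (abs_op T x) x = (rinner (abs_op T x) x)%:C :> R[i].
  by rewrite /rinner RRe_real // ger0_real // P0.
rewrite !fctE innerDl innerZl inner_Re_op // -scaleN1r innerZl mulN1r Pr.
rewrite -rmorphM -rmorphB lecR subr_ge0.
set s := Num.sqrt (M * m).
have s0 : 0 < s by rewrite sqrtr_gt0 mulr_gt0.
have s2 : s ^+ 2 = M * m by rewrite sqr_sqrtr // mulr_ge0 // ltW.
rewrite mulrAC ler_pdivlMr ?mulr_gt0 // mulrC.
have := sqr_ge0 (hnorm (abs_op T x - s%:C *: x)).
rewrite hnormB_sqr hnormZ rinnerZr exprMn real_normK ?num_real // s2.
rewrite hnorm_abs_op //.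
have := C_op_accretive_le x Tb TC; lra.
Qed.

End HilbertSpace.

Theorem theorem2p1 (R : realType) (M m : R) (hm : 0 < m) (hmM : m < M)
    (H : hilbertType R) (A : H -> H) (hA : bounded_op A) :
  [/\ accretive (C_op M m A) ->
        le_op (abs_op A) (((M + m) / (2 * Num.sqrt (M * m)))%:C *: Re_op A),
      accretive (C_op M m ('i *: adjoint A)) ->
        le_op (abs_op (adjoint A))
              (((M + m) / (2 * Num.sqrt (M * m)))%:C *: Im_op A)
    & invertible_op A -> accretive (C_op M m (inverse_op A)) ->
        le_op (abs_op (inverse_op A))
              (((M + m) / (2 * Num.sqrt (M * m)))%:C *: Re_op (inverse_op A))].
Proof.
have M0 : 0 < M by exact: lt_trans hmM.
split; first exact: abs_op_le_Re_op.
  have [Aab _] := adjoint_spec hA.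
  (* T = i A^* has T^* T = A A^* and real part Im A. *)
  have iAb : bounded_op ('i *: adjoint A) by exact: bounded_opZ.
  have iAadj : adjoint ('i *: adjoint A) = - 'i *: A.
    rewrite adjointZ // adjointK //; congr (_ *: _).
    by apply/eqP; rewrite eq_complex /= oppr0 !eqxx.
  have -> : abs_op (adjoint A) = abs_op ('i *: adjoint A).
    rewrite /abs_op iAadj adjointK //; congr sqrt_op.
    apply: funext => x /=; rewrite !fctE (linear_opZ hA.1) scalerA mulNr.
    by rewrite -expr2 sqr_i opprK scale1r.
  have -> : Im_op A = Re_op ('i *: adjoint A).
    rewrite /Im_op /Re_op iAadj invfM -scalerA; congr (_ *: _).
    by rewrite invCi scalerBr !scaleNr opprK addrC.
  exact: abs_op_le_Re_op.
by move=> /getPex[iAb _ _]; exact: abs_op_le_Re_op.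
Qed.
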